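(* Let $\{(N_k,B_k)\}_{k=1}^\infty$ be a sequence where, for every $k\ge 1$, $N_k\ge 2$ and $B_k\subset\mathbb{R}$ is finite and nonempty. Then for every sequence $\mathbf{n}=\{n_k\}_{k=1}^\infty$ of positive integers and every integer $k>0$, the mapping $\mu_k^{\mathbf{n}}:\Omega\times\mathcal{B}(\mathbb{R})\to[0,+\infty]$, $(\boldsymbol{\omega},B)\mapsto \mu_k^{\mathbf{n}}(\boldsymbol{\omega})(B)$, is a random measure on $(\mathbb{R},\mathcal{B}(\mathbb{R}))$ with respect to $(\Omega,\mathcal{F})$.
   Context: $\Omega=\mathbb{N}^{\mathbb{N}}$ with index set $\mathbb{N}=\{1,2,3,\dots\}$ is the set of infinite sequences $\boldsymbol{\omega}=\omega_1\omega_2\cdots$ of positive integers, with the metric $d(\boldsymbol{\alpha},\boldsymbol{\beta})=2^{-|\boldsymbol{\alpha}\wedge\boldsymbol{\beta}|}$, where $|\boldsymbol{\alpha}\wedge\boldsymbol{\beta}|$ is the length of the maximal common initial segment ($d=0$ if the sequences are equal). $\mathcal{F}$ is the Borel $\sigma$-algebra of $\Omega$; $\mathcal{B}(\mathbb{R})$ is the Borel $\sigma$-algebra of $\mathbb{R}$. For a finite nonempty $A\subset\mathbb{R}$, $\delta_A=\frac{1}{\#A}\sum_{a\in A}\delta_a$ with $\delta_a$ the Dirac measure at $a$; $cA=\{ca:a\in A\}$; $*$ is convolution of measures. Each $N_k$ is a real number $\ge 2$. For $\boldsymbol{\omega}\in\Omega$ and $k\ge1$, $$\mu^{\mathbf{n}}_{k}(\boldsymbol{\omega})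 =\delta_{N_{\omega_{1}}^{-n_{1}}B_{\omega_{1}}} * \delta_{N_{\omega_{1}}^{-n_{1}}N_{\omega_{2}}^{-n_{2}}B_{\omega_{2}}} * \cdots * \delta_{N_{\omega_{1}}^{-n_{1}}N_{\omega_{2}}^{-n_{2}}\cdots N_{\omega_{k}}^{-n_{k}}B_{\omega_{k}}}.$$ A mapping $M:\Omega\times\mathcal{E}\to[0,+\infty]$ is a random measure on a measurable space $(E,\mathcal{E})$ with respect to $(\Omega,\mathcal{F})$ if (i) $\boldsymbol{\omega}\mapsto M(\boldsymbol{\omega},A)$ is $\mathcal{F}$-measurable for every $A\in\mathcal{E}$, and (ii) $A\mapsto M(\boldsymbol{\omega},A)$ is a measure on $(E,\mathcal{E})$ for every $\boldsymbol{\omega}\in\Omega$. *)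

(* Defs.v *)
From HB Require Import structures.
From mathcomp Require Import all_boot all_order all_algebra.
From mathcomp Require Import finmap.
From mathcomp Require Import all_classical all_reals all_analysis.
From mathcomp Require Import measurable_realfun.
Import Order.TTheory GRing.Theory Num.Theory.
Import numFieldNormedType.Exports.

Set Implicit Arguments.
Unset Strict Implicit.
Unset Printing Implicit Defensive.

Local Open Scope classical_set_scope.
Local Open Scope ring_scope.

Definition posnat := {n : nat | (0 < n)%N}.
HB.instance Definition _ := Countable.on posnat.
HB.instance Definition _ := isPointed.Build posnat (exist _ 1%N isT).

(* [pos i] is the (i+1)-st positive integer, so that the terms of a sequence
   [u : posnat -> T] are, in order, [u (pos 0), u (pos 1), ...]. *)
Definition pos (i : nat) : posnat := exist _ i.+1 (ltn0Sn i).

(* [R] is a phantom parameter: it is where the metric takes its values. *)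
Definition Omega (R : realType) : Type := posnat -> posnat.
HB.instance Definition _ (R : realType) :=
  Choice.copy (Omega R) (posnat -> posnat).
HB.instance Definition _ (R : realType) :=
  isPointed.Build (Omega R) (fun=> point).

Section metric.
Variable R : realType.
Implicit Types a b c : Omega R.

Definition initial_segment a (m : nat) : seq posnat :=
  [seq a (pos i) | i <- iota 0 m].

Definition common_segment a b (m : nat) : Prop :=
  initial_segment a m = initial_segment b m.

(* The junk value 0 is only taken when [a = b]. *)
Definition wedge_length a b : nat :=
  xget 0%N [set m | common_segment a b m /\
                    forall m', common_segment a b m' -> (m' <= m)%N].

Definition Omega_dist a b : R :=
  if a == b then 0 else 2^-1 ^+ wedge_length a b.

Lemma common_segmentP a b m :
  common_segment a b m <-> forall i, (i < m)%N -> a (pos i) = b (pos i).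
Proof.
rewrite /common_segment /initial_segment; split.
- move=> /eq_in_map h i im; apply: h.
  by rewrite mem_iota add0n.
- move=> h; apply/eq_in_map => i; rewrite mem_iota add0n => /andP[_ im].
  exact: h.
Qed.

Lemma posK (p : posnat) : pos (val p).-1 = p.
Proof. by apply: val_inj => /=; rewrite prednK//; case: p. Qed.

Lemma wedge_lengthP a b : a != b ->
  common_segment a b (wedge_length a b) /\
  forall m, common_segment a b m -> (m <= wedge_length a b)%N.
Proof.
move=> /eqP ab; rewrite /wedge_length; case: xgetP => [m _ []//|h].
have [i0 hi0] : exists i, a (pos i) != b (pos i).
  apply: contrapT => /forallNP H; apply: ab; apply/funext => p.
  by have /negP := H (val p).-1; rewrite negbK posK => /eqP.
case: (@ex_minnP (fun i => a (pos i) != b (pos i)) (ex_intro _ i0 hi0)).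
move=> m hm mmin.
exfalso; apply: (h m); split.
- apply/common_segmentP => i im; apply/eqP/negPn/negP => /mmin.
  by rewrite leqNgt im.
- move=> m' /common_segmentP h'; rewrite leqNgt; apply/negP => /h' e.
  by move: hm; rewrite e eqxx.
Qed.

Lemma Omega_distxx a : Omega_dist a a = 0.
Proof. by rewrite /Omega_dist eqxx. Qed.

Lemma Omega_dist_positivity a b : Omega_dist a b = 0 -> a = b.
Proof.
rewrite /Omega_dist; case: eqVneq => // _ /eqP.
by rewrite expf_eq0 invr_eq0 pnatr_eq0 andbF.
Qed.

Lemma Omega_dist_sym a b : Omega_dist a b = Omega_dist b a.
Proof.
rewrite /Omega_dist eq_sym; congr (if _ then _ else _ ^+ _).
by rewrite /wedge_length; congr xget; apply/seteqP; split => m [h1 h2];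
  split => [|m' h]; rewrite /common_segment 1?(esym h1)//; apply: h2; exact: esym.
Qed.

Lemma Omega_dist_ge0 a b : 0 <= Omega_dist a b.
Proof. by rewrite /Omega_dist; case: ifP => // _; rewrite exprn_ge0. Qed.

Lemma Omega_dist_triangle b a c :
  Omega_dist a c <= Omega_dist a b + Omega_dist b c.
Proof.
have [->|ab] := eqVneq a b; first by rewrite Omega_distxx add0r.
have [->|bc] := eqVneq b c; first by rewrite Omega_distxx addr0.
have [->|ac] := eqVneq a c.
  by rewrite Omega_distxx addr_ge0// Omega_dist_ge0.
have [/common_segmentP h1 _] := wedge_lengthP ab.
have [/common_segmentP h2 _] := wedge_lengthP bc.
have [_ /(_ (minn (wedge_length a b) (wedge_length b c)))] := wedge_lengthP ac.
have /[swap]/[apply] : common_segment a c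
    (minn (wedge_length a b) (wedge_length b c)).
  apply/common_segmentP => i; rewrite leq_min => /andP[i1 i2].
  by rewrite h1// h2.
have E x y : x != y -> Omega_dist x y = 2^-1 ^+ wedge_length x y.
  by rewrite /Omega_dist => /negbTE ->.
have D m m' : (m <= m')%N -> (2^-1 : R) ^+ m' <= 2^-1 ^+ m.
  by move=> mm; apply: ler_wiXn2l => //; rewrite invf_le1// ler1n.
rewrite !E// geq_min => /orP[/D h|/D h]; apply: (le_trans h).
- by rewrite lerDl exprn_ge0.
- by rewrite lerDr exprn_ge0.
Qed.

HB.instance Definition _ := @isMetric.Build R (Omega R) Omega_dist
  Omega_distxx Omega_dist_positivity Omega_dist_sym Omega_dist_triangle.

End metric.

Definition OmegaBorel (R : realType) : Type :=
  g_sigma_algebraType (@open (Omega R)).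
HB.instance Definition _ (R : realType) := Measurable.on (OmegaBorel R).

Section delta_set.
Local Open Scope ereal_scope.
Context {R : realType}.

(* [fset_set A] is the finite set [A] as an {fset R} (empty, hence with the zero
   measure as a junk value, if [A] is infinite). *)
Definition delta_set (A : set R) : set R -> \bar R := fun U =>
  (#|` fset_set A|%:R^-1)%R%:E * \sum_(a <- fset_set A) \d_a U.

Variable A : set R.

Let c : {nonneg R} := ((#|` fset_set A|%:R^-1)%:nng)%R.
Let m : {measure set R -> \bar R} :=
  mscale c (msum (fun i => \d_(nth 0%R (fset_set A) i)) #|` fset_set A|).

Let delta_setE : delta_set A = m.
Proof.
apply/funext => U; rewrite /m/= /mscale/= /msum /delta_set.
by rewrite (big_nth 0%R) big_mkord.
Qed.

Let delta_set0 : delta_set A set0 = 0.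
Proof. by rewrite delta_setE measure0. Qed.

Let delta_set_ge0 U : 0 <= delta_set A U.
Proof. by rewrite delta_setE; exact: measure_ge0. Qed.

Let delta_set_sigma_additive : semi_sigma_additive (delta_set A).
Proof. by rewrite delta_setE; exact: measure_semi_sigma_additive. Qed.

HB.instance Definition _ := isMeasure.Build _ _ _ (delta_set A)
  delta_set0 delta_set_ge0 delta_set_sigma_additive.

Let delta_set_fin : fin_num_fun (delta_set A).
Proof.
move=> U mU; rewrite /delta_set fin_numM//.
elim/big_ind : _ => [//|x y fx fy|a _]; first by rewrite fin_numD fx fy.
by rewrite diracE.
Qed.

HB.instance Definition _ := Measure_isFinite.Build _ _ _ (delta_set A)
  delta_set_fin.

End delta_set.

Section convolution.
Local Open Scope ereal_scope.
Context {R : realType}.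
Variables mu nu : {finite_measure set R -> \bar R}.

Definition convolution : set R -> \bar R :=
  pushforward (mu \x nu) (fun z : R * R => (z.1 + z.2)%R).

Let measurable_sum :
  measurable_fun [set: R * R] (fun z : R * R => (z.1 + z.2)%R).
Proof. by apply: measurable_funD. Qed.

Let convolution0 : convolution set0 = 0.
Proof. by rewrite /convolution /pushforward preimage_set0 measure0. Qed.

Let convolution_ge0 U : 0 <= convolution U.
Proof. exact: measure_ge0. Qed.

Let convolution_sigma_additive : semi_sigma_additive convolution.
Proof. exact: measure_semi_sigma_additive. Qed.

HB.instance Definition _ := isMeasure.Build _ _ _ convolution
  convolution0 convolution_ge0 convolution_sigma_additive.

Let convolution_fin : fin_num_fun convolution.
Proof.
apply: lty_fin_num_fun.
suff : (mu \x nu) (setT `*` setT) < +oo by rewrite setXTT.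
rewrite product_measure1E//.
by rewrite lte_mul_pinfty// ?fin_num_measure// ltey_eq fin_num_measure.
Qed.

HB.instance Definition _ := Measure_isFinite.Build _ _ _ convolution
  convolution_fin.

Definition convolve : {finite_measure set R -> \bar R} := convolution.

End convolution.

Section random_measure.
Context d d' (W : measurableType d) (E : measurableType d') (R : realType).

(* A set function is total on [set E]; only its values on the measurable sets
   are constrained. *)
Definition random_measure (M : W -> set E -> \bar R) : Prop :=
  (forall A, measurable A -> measurable_fun [set: W] (fun w => M w A)) /\
  (forall w, exists m : {measure set E -> \bar R},
     forall A, measurable A -> M w A = m A).

End random_measure.

Section mu.
Context {R : realType}.
Variables (N : posnat -> R) (B : posnat -> set R) (n : posnat -> posnat).

Definition dilate (c : R) (A : set R) : set R := [set c * a | a in A].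

(* N_{w_1}^{-n_1} ... N_{w_k}^{-n_k} *)
Definition scale_factor (w : Omega R) (k : nat) : R :=
  \prod_(i < k) N (w (pos i)) ^- val (n (pos i)).

(* [j] counts from 0: this is the factor carrying the digit set B_{w_{j+1}}. *)
Definition mu_factor (w : Omega R) (j : nat) :
    {finite_measure set R -> \bar R} :=
  delta_set (dilate (scale_factor w j.+1) (B (w (pos j)))).

Definition mu (k : posnat) (w : Omega R) :
    {finite_measure set R -> \bar R} :=
  foldl convolve (mu_factor w 0) [seq mu_factor w j | j <- iota 1 (val k).-1].

End mu.

(* Main.v *)
Require Import Defs.
From HB Require Import structures.
From mathcomp Require Import all_boot all_order all_algebra.
From mathcomp Require Import all_classical all_reals all_analysis.
Import Order.TTheory GRing.Theory Num.Theory.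
Import numFieldNormedType.Exports.
Local Open Scope classical_set_scope.
Local Open Scope ring_scope.

(** For a fixed sequence [w] the set function is a finite convolution of
    measures, hence a measure.  Measurability in [w] comes from the fact that
    the convolution of the first [k] factors reads only the first [k] terms of
    [w] ([eq_mu]).  Two sequences at distance less than [2^-k] share these
    terms ([ball_common_segment]), so [w |-> mu k w A] is locally constant, and
    the preimage of any set whatsoever under it is open
    ([open_common_segment]). *)

(** Agreement of two sequences at distance less than [2^-k] may fail only from
    a position beyond [k] on, because the powers of 1/2 decrease. *)
Lemma ball_common_segment (R : realType) (k : nat) (v w : Omega R) :
  ball v (2^-1 ^+ k) w -> common_segment v w k.
Proof.
rewrite ballEmdist/= /mdist/= /Omega_dist.
have [-> //|vw] := eqVneq v w.
have [/common_segmentP vw_agree _] := wedge_lengthP vw.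
rewrite ltr_iXn2l ?invr_gt0 ?invf_lt1 ?ltr1n// => k_lt.
by apply/common_segmentP => i /ltn_trans/(_ k_lt)/vw_agree.
Qed.

(** Such a set is the union of the balls of radius [2^-k] around its points. *)
Lemma open_common_segment (R : realType) (k : nat) (S : set (Omega R)) :
  (forall v w, common_segment v w k -> S v -> S w) -> open S.
Proof.
move=> S_segment; rewrite openE => v Sv.
apply/nbhs_ballP; exists (2^-1 ^+ k) => /=; first by rewrite exprn_gt0// invr_gt0.
by move=> w /ball_common_segment/S_segment; exact.
Qed.

Lemma measurable_fun_common_segment (R : realType) d (T : sigmaRingType d)
    (k : nat) (f : OmegaBorel R -> T) :
  (forall v w : Omega R, common_segment v w k -> f v = f w) ->
  measurable_fun setT f.
Proof.
move=> f_segment _ Y _; rewrite setTI; apply: sub_sigma_algebra.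
by apply: (@open_common_segment R k) => v w /f_segment /= ->.
Qed.

Section dependence_on_initial_segment.
Context (R : realType) (N : posnat -> R) (B : posnat -> set R).
Variables (n : posnat -> posnat) (v w : Omega R).

Lemma eq_scale_factor (k : nat) :
  common_segment v w k -> scale_factor N n v k = scale_factor N n w k.
Proof.
by move=> /common_segmentP vw; apply: eq_bigr => i _; rewrite vw.
Qed.

Lemma eq_mu_factor (j : nat) :
  common_segment v w j.+1 -> mu_factor N B n v j = mu_factor N B n w j.
Proof.
move=> vw; rewrite /mu_factor eq_scale_factor//.
by move/common_segmentP: vw => ->.
Qed.

Lemma eq_mu (k : posnat) :
  common_segment v w (val k) -> mu N B n k v = mu N B n k w.
Proof.
move=> /common_segmentP vw.
have eq_factor j : (j < val k)%N -> mu_factor N B n v j = mu_factor N B n w j.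
  move=> jk; apply/eq_mu_factor/common_segmentP => i ij.
  by apply: vw; exact: leq_trans jk.
have k_gt0 : (0 < val k)%N by case: k {vw eq_factor}.
rewrite /mu eq_factor//; congr foldl; apply/eq_in_map => j.
by rewrite mem_iota add1n prednK// => /andP[_ /eq_factor].
Qed.

End dependence_on_initial_segment.

Theorem theorem1p1 (R : realType) (N : posnat -> R) (B : posnat -> set R)
    (N_ge2 : forall k, 2 <= N k)
    (B_finite : forall k, finite_set (B k))
    (B_nonempty : forall k, B k !=set0)
    (n : posnat -> posnat) (k : posnat) :
  random_measure
    (fun (w : OmegaBorel R) (A : set R) => mu N B n k w A).
Proof.
split=> [A mA|w]; last by exists (mu N B n k w).
by apply: (@measurable_fun_common_segment R _ _ (val k)) => v w /eq_mu ->.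
Qed.
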